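(* Let $G:\mathbb{R}^d\to\mathbb{R}$ be a function for which there exist constants $L,M>0$ and $\alpha\in(0,1]$ such that $\sup_{x\in\mathbb{R}^d}|G(x)|\le M$ and $|G(x)-G(y)|\le L|x-y|^{\alpha}$ for all $x,y\in\mathbb{R}^d$, and let $\mathbb{E}[|x_0|^2]<\infty$. Then for each $\xi\in\arg\min_{x\in\mathbb{R}^d}G(x)$ there is a constant $C$, depending only on the dimension $d$, the regularity of $G$ (through $L$ and $\alpha$), and $\mathbb{E}[|x_0-\xi|^2]$, such that for all $\varepsilon\in(0,e^{-1})$, $$0\le \mathbb{E}\left[V_{\varepsilon}(0,x_0)\right]-G(\xi)\le C\,\varepsilon\,\ln\left(\frac{1}{\varepsilon}\right).$$
   Context: $W=(W_t)_{t\ge0}$ is a standard $d$-dimensional Wiener process and $x_0$ an $\mathbb{R}^d$-valued random variable on a complete filtered probability space $(\Omega,\mathcal{F},(\mathcal{F}_t)_{t\ge 0},\mathbb{P})$; the filtration is generated by $x_0$ and $W$ and augmented by the null sets; $x_0$ is $\mathcal{F}_0$-measurable and independent of $W$. $\Theta$ is the set of admissible controls, i.e. of $(\mathcal{F}_t)$-adapted $\mathbb{R}^d$-valued processes $\theta$ on $[0,1]$ with $\mathbb{E}\big[\big(\int_0^1|\theta_s|ds\big)^2\big]<\infty$. For $(t,x)\in[0,1]\times\mathbb{R}^d$ and $\theta\in\Theta$ put $X_s^{t,x;\theta}=x+\int_t^s\theta_r\,dr+W_s-W_t$ for $s\in[t,1]$. The value function is $$V_\varepsilon(t,x)=\inf_{\theta\in\Theta}\mathbb{E}\left[G(X_1^{t,x;\theta})+\frac{\varepsilon}{2}\int_t^1|\theta_s|^2ds\right].$$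 *)

(* Defs.v *)
From mathcomp Require Export all_boot all_order all_algebra.
From mathcomp Require Export all_classical all_reals all_analysis.
Export Order.TTheory GRing.Theory Num.Theory.
Export numFieldNormedType.Exports.

Set Implicit Arguments.
Unset Strict Implicit.
Unset Printing Implicit Defensive.

Local Open Scope classical_set_scope.
Local Open Scope ring_scope.

(* Euclidean norm; the norm `|x| that the library puts on row vectors is the
   sup norm. *)
Definition enorm (R : realType) (d : nat) (x : 'rV[R]_d) : R :=
  Num.sqrt (\sum_(i < d) x 0 i ^+ 2).

Definition argmin (R : realType) (d : nat) (G : 'rV[R]_d -> R) :
    set 'rV[R]_d :=
  [set x | forall y, G x <= G y].

(* A vector is random, or a process measurable, when its coordinates are: the
   Borel sigma-algebra of R^d is the d-fold product of that of R. *)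
Definition random_vector (R : realType) (d : nat) (disp : measure_display)
    (Omega : measurableType disp) (X : Omega -> 'rV[R]_d) : Prop :=
  forall i, measurable_fun setT (fun w => X w 0 i).

Definition coord_events (R : realType) (d : nat) (Omega : Type)
    (X : Omega -> 'rV[R]_d) : set (set Omega) :=
  \bigcup_i preimage_set_system setT (fun w => X w 0 i) measurable.

Definition indep (R : realType) (disp : measure_display)
    (Omega : measurableType disp) (P : probability Omega R)
    (A B : set (set Omega)) : Prop :=
  forall a b, A a -> B b -> P (a `&` b) = (P a * P b)%E.

Definition sigma_vector (R : realType) (d : nat) (Omega : Type)
    (X : Omega -> 'rV[R]_d) : set (set Omega) :=
  <<s coord_events X >>.

(* Processes are indexed by all of R, but only their values at nonnegative
   times (times in [0, 1], for controls) are ever used. *)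
Definition sigma_process (R : realType) (d : nat) (Omega : Type)
    (J : set R) (X : R -> Omega -> 'rV[R]_d) : set (set Omega) :=
  <<s \bigcup_(t in J) coord_events (X t) >>.

(* [normal_prob] takes the standard deviation, not the variance; the product
   in the fourth clause says that W t - W s has law N(0, (t - s) I_d). *)
Record wiener (R : realType) (d : nat) (disp : measure_display)
    (Omega : measurableType disp) (P : probability Omega R)
    (W : R -> Omega -> 'rV[R]_d) : Prop := Wiener {
  wiener_rv : forall t, 0 <= t -> random_vector (W t) ;
  wiener0 : {ae P, forall w, W 0 w = 0} ;
  wiener_indep : forall s t, 0 <= s -> s < t ->
    indep P (sigma_vector (fun w => W t w - W s w))
            (sigma_process `[0, s] W) ;
  wiener_normal : forall s t, 0 <= s -> s < t ->
    forall B : 'I_d -> set R, (forall i, measurable (B i)) ->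
    P [set w | forall i, B i (W t w 0 i - W s w 0 i)] =
    (\prod_(i < d) normal_prob 0 (Num.sqrt (t - s)) (B i))%E ;
  wiener_continuous :
    {ae P, forall w, {within `[0, +oo[, continuous (fun t : R => W t w)}}
}.

Definition filtration (R : realType) (d : nat) (disp : measure_display)
    (Omega : measurableType disp) (P : probability Omega R)
    (x0 : Omega -> 'rV[R]_d) (W : R -> Omega -> 'rV[R]_d) (t : R) :
    set (set Omega) :=
  <<s coord_events x0 `|` \bigcup_(r in `[0, t]) coord_events (W r)
      `|` [set N | P.-negligible N] >>.

(* Joint measurability in (s, w), which makes the time integrals of a control
   and the expectations of these meaningful, is part of being a process. *)
Record admissible (R : realType) (d : nat) (disp : measure_display)
    (Omega : measurableType disp) (P : probability Omega R)
    (x0 : Omega -> 'rV[R]_d) (W : R -> Omega -> 'rV[R]_d)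
    (theta : R -> Omega -> 'rV[R]_d) : Prop := Admissible {
  admissible_measurable : forall i,
    measurable_fun (`[0%R, 1%R] `*` setT : set (R * Omega))
      (fun z => theta z.1 z.2 0 i) ;
  admissible_adapted : forall s, s \in `[0, 1] ->
    coord_events (theta s) `<=` filtration P x0 W s ;
  admissible_moment :
    (\int[P]_w
       (\int[lebesgue_measure]_(s in `[0%R, 1%R]) (enorm (theta s w))%:E) ^+ 2
     < +oo)%E
}.

Definition state (R : realType) (d : nat) (Omega : Type)
    (W theta : R -> Omega -> 'rV[R]_d) (t : R) (x : 'rV[R]_d) (s : R)
    (w : Omega) : 'rV[R]_d :=
  x + (\row_i \int[lebesgue_measure]_(r in `[t, s]) theta r w 0 i)
    + W s w - W t w.

(* The running cost may be infinite, so costs and values are extended reals. *)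
Definition cost (R : realType) (d : nat) (disp : measure_display)
    (Omega : measurableType disp) (P : probability Omega R)
    (W : R -> Omega -> 'rV[R]_d) (G : 'rV[R]_d -> R) (eps t : R)
    (x : 'rV[R]_d) (theta : R -> Omega -> 'rV[R]_d) : \bar R :=
  (\int[P]_w ((G (state W theta t x 1 w))%:E +
     (eps / 2)%:E *
     \int[lebesgue_measure]_(s in `[t, 1%R]) (enorm (theta s w) ^+ 2)%:E))%E.

Definition value (R : realType) (d : nat) (disp : measure_display)
    (Omega : measurableType disp) (P : probability Omega R)
    (x0 : Omega -> 'rV[R]_d) (W : R -> Omega -> 'rV[R]_d)
    (G : 'rV[R]_d -> R) (eps t : R) (x : 'rV[R]_d) : \bar R :=
  ereal_inf [set cost P W G eps t x theta |
              theta in [set theta | admissible P x0 W theta]].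

(* Main.v *)
(* Fix a minimiser xi and cut [0, 1[ into the dyadic cells [t_k, t_(k+1)[ with
   t_k = 1 - 2^-k.  On each cell k <= m the control is constant and cancels,
   over the length of the cell, a displacement that has already occurred: x - xi
   for k = 0, and W_(t_k) - W_(t_(k-1)) afterwards.  The state at time 1 is then
   exactly xi + W_1 - W_(t_m).  Each cell is half as long as the previous one,
   so each k >= 1 costs a bounded mean energy and the total energy is O(m),
   while the final displacement has variance of order 2^-m.  Taking 2^-m of
   order eps^(2/alpha), that is m of order ln (1/eps), makes the terminal cost
   exceed G xi by O(eps). *)
From HB Require Import structures.
Require Import Defs.
From mathcomp Require Import measurable_realfun ring lra.

Set Implicit Arguments.
Unset Strict Implicit.
Unset Printing Implicit Defensive.

Local Open Scope classical_set_scope.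
Local Open Scope ring_scope.

(* Needed because nothing says that the value function, or a cost, is
   measurable: the integral of a nonnegative function is the supremum over the
   simple functions below it, which is monotone in any case. *)
Lemma le_integral_unmeasurable d (T : measurableType d) (R : realType)
    (mu : {measure set T -> \bar R}) (D : set T) (f g : T -> \bar R) :
  (forall x, D x -> f x <= g x)%E ->
  (\int[mu]_(x in D) f x <= \int[mu]_(x in D) g x)%E.
Proof.
move=> fg.
have {}fg x : ((f \_ D) x <= (g \_ D) x)%E.
  by rewrite /patch; case: ifPn => // /set_mem/fg.
rewrite /integral leeB//; apply: ereal_sup_le => _ [h hle <-];
  exists h => // x.
- by apply: le_trans (hle x) _; apply: (@funepos_le _ _ setT); rewrite ?inE.
- by apply: le_trans (hle x) _; apply: (@funeneg_le _ _ setT); rewrite ?inE.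
Qed.

(** * Second moment of the normal law *)

(** [normal_pdf] and the Radon-Nikodym derivative of [normal_prob] have the same integral over every
    measurable set, so they agree almost everywhere and change of variables applies. *)
Lemma ge0_integral_normal_prob (R : realType) (m s : R) (f : R -> \bar R) :
  measurable_fun setT f -> (forall x, 0 <= f x)%E ->
  (\int[normal_prob m s]_x f x
   = \int[lebesgue_measure]_x (f x * (normal_pdf m s x)%:E))%E.
Proof.
move=> mf f0.
have dom := @normal_prob_dominates R m s.
pose mu := @lebesgue_measure R.
rewrite -(@Radon_Nikodym_SigmaFinite.change_of_variables _ _ _
  (normal_prob m s) mu dom)//.
apply: ae_eq_integral => //.
- apply: emeasurable_funM => //.
  apply: (measurable_int mu).
  exact: Radon_Nikodym_SigmaFinite.f_integrable.
- apply: emeasurable_funM => //; apply/measurable_EFinP.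
  exact: measurable_normal_pdf.
- apply: ae_eqe_mul2l.
  apply: integral_ae_eq => //.
  + exact: Radon_Nikodym_SigmaFinite.f_integrable.
  + by apply/measurable_EFinP; exact: measurable_normal_pdf.
  + move=> E _ mE; rewrite -Radon_Nikodym_SigmaFinite.f_integral//.
Qed.

(* Doubling the standard deviation absorbs the factor x ^+ 2, which bounds the
   second moment without computing it. *)
Lemma sqr_normal_pdf_le (R : realType) (s x : R) : 0 < s ->
  x ^+ 2 * normal_pdf 0 s x <= 6 * s ^+ 2 * normal_pdf 0 (2 * s) x.
Proof.
move=> s0; have s2 : 0 < s ^+ 2 by rewrite exprn_gt0.
rewrite !normal_pdfE ?gt_eqF ?mulr_gt0// /normal_fun /normal_peak subr0.
have -> : (2 * s) ^+ 2 * pi *+ 2 = 2 ^+ 2 * (s ^+ 2 * pi *+ 2) :> R by ring.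
rewrite sqrtrM ?exprn_ge0// sqrtr_sqr normr_nat invfM.
set p := (Num.sqrt _)^-1; have p0 : 0 <= p by rewrite invr_ge0 sqrtr_ge0.
(* In terms of [v] the two exponents are - 4 v and - v. What remains is 3 v exp(- 3 v) <= 1, and the
   constants then compare as 8 / 3 <= 3. *)
pose v := x ^+ 2 / (8 * s ^+ 2).
have xE : x ^+ 2 = v * (8 * s ^+ 2) by rewrite /v divfK// gt_eqF ?mulr_gt0.
have -> : - x ^+ 2 / (s ^+ 2 *+ 2) = - v - 3 * v.
  by rewrite xE; field; rewrite gt_eqF.
have -> : - x ^+ 2 / ((2 * s) ^+ 2 *+ 2) = - v.
  by rewrite xE; field; rewrite gt_eqF.
rewrite expRD (expRN (3 * v)); set e := expR (- v).
have e0 : 0 <= e by exact: expR_ge0.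
have v0 : 0 <= v by rewrite /v divr_ge0 ?sqr_ge0// mulr_ge0// ltW.
have : 3 * v / expR (3 * v) <= 1.
  by rewrite ler_pdivrMr ?expR_gt0// mul1r (le_trans _ (expR_ge1Dx _))// lerDr.
set q := (expR (3 * v))^-1 => vq.
have pe : 0 <= p * e * s ^+ 2 by rewrite !mulr_ge0// ltW.
have -> : x ^+ 2 * (p * (e * q)) = 8 / 3 * (3 * v * q) * (p * e * s ^+ 2).
  by rewrite xE; field.
have -> : 6 * s ^+ 2 * (2^-1 * p * e) = 3 * (p * e * s ^+ 2) by field.
by rewrite ler_wpM2r//; lra.
Qed.

Lemma normal_second_moment_le (R : realType) (s : R) : 0 < s ->
  (\int[normal_prob 0 s]_x (x ^+ 2)%:E <= (6 * s ^+ 2)%:E)%E.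
Proof.
move=> s0.
have mX : measurable_fun [set: R] (fun x : R => (x ^+ 2)%:E).
  exact/measurable_EFinP/measurable_funX.
rewrite ge0_integral_normal_prob//; last by move=> x; rewrite lee_fin sqr_ge0.
rewrite -[leRHS]mule1 -(integral_normal_pdf 0 (2 * s)) -ge0_integralZl//.
- apply: le_integral_unmeasurable => x _.
  by rewrite -!EFinM lee_fin sqr_normal_pdf_le.
- by apply/measurable_EFinP; exact: measurable_normal_pdf.
- by move=> x _; rewrite lee_fin normal_pdf_ge0.
- by rewrite lee_fin mulr_ge0 ?sqr_ge0.
Qed.

(** * Euclidean norm and increments of the Wiener process *)

Lemma enorm_ge0 (R : realType) (d : nat) (x : 'rV[R]_d) : 0 <= enorm x.
Proof. exact: sqrtr_ge0. Qed.

Lemma enorm_sqr (R : realType) (d : nat) (x : 'rV[R]_d) :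
  enorm x ^+ 2 = \sum_(i < d) x 0 i ^+ 2.
Proof. by rewrite sqr_sqrtr// sumr_ge0// => i _; exact: sqr_ge0. Qed.

Section wiener_increments.
Context (R : realType) (d : nat) (disp : measure_display)
  (Omega : measurableType disp) (P : probability Omega R)
  (W : R -> Omega -> 'rV[R]_d) (wienerW : wiener P W).
Context (s t : R) (s0 : 0 <= s) (st : s < t).

Lemma measurable_increment (i : 'I_d) :
  measurable_fun setT (fun w => W t w 0 i - W s w 0 i).
Proof.
have t0 : 0 <= t by apply: ltW; exact: le_lt_trans st.
by apply: measurable_funB; exact: (wiener_rv wienerW).
Qed.

(** Marginal of the product law: the other coordinates are left free, each contributing a factor
    1. *)
Lemma wiener_coord_normal (i : 'I_d) (B : set R) : measurable B ->
  P ((fun w => W t w 0 i - W s w 0 i) @^-1` B)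
  = normal_prob 0 (Num.sqrt (t - s)) B.
Proof.
move=> mB.
have := wiener_normal wienerW s0 st
  (B := fun j => if j == i then B else setT).
rewrite (bigD1 i)//= eqxx big1 ?mule1 => [|j /negbTE ->]; last first.
  exact: probability_setT.
move=> <- => [|j]; last by case: ifP.
congr (P _); apply/seteqP; split => w /=; last by move=> /(_ i); rewrite eqxx.
by move=> BW j; case: eqVneq => // ->.
Qed.

(** The integral is carried over to the law of the increment. The factor 6, where the exact value is
    1, is inherited from the comparison of densities. *)
Lemma coord_increment_moment_le (i : 'I_d) :
  (\int[P]_w ((W t w 0 i - W s w 0 i) ^+ 2)%:E <= (6 * (t - s))%:E)%E.
Proof.
have ts : 0 < t - s by rewrite subr_gt0.
pose X : Omega -> measurableTypeR R := fun w => W t w 0 i - W s w 0 i.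
have mX : measurable_fun setT X by exact: measurable_increment.
have -> : t - s = Num.sqrt (t - s) ^+ 2 by rewrite sqr_sqrtr// ltW.
apply: le_trans (normal_second_moment_le _); last by rewrite sqrtr_gt0.
have m2 : measurable_fun [set: measurableTypeR R] (fun x : R => (x ^+ 2)%:E).
  exact/measurable_EFinP/measurable_funX.
pose X' : {RV P >-> measurableTypeR R} :=
  HB.pack X (isMeasurableFun.Build _ _ _ _ _ mX).
rewrite -(ge0_integral_distribution X' m2); last first.
  by move=> y; rewrite lee_fin sqr_ge0.
rewrite le_eqVlt; apply/orP; left; apply/eqP.
by apply: eq_measure_integral => A mA _; exact: wiener_coord_normal.
Qed.

Lemma increment_moment_le :
  (\int[P]_w (enorm (W t w - W s w) ^+ 2)%:E <= (6 * d%:R * (t - s))%:E)%E.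
Proof.
under eq_integral => w _.
  rewrite enorm_sqr -sumEFin.
  under eq_bigr do rewrite !mxE.
  over.
rewrite ge0_integral_sum//; first last.
- by move=> i w _; rewrite lee_fin sqr_ge0.
- move=> i; apply/measurable_EFinP/measurable_funX; exact: measurable_increment.
apply: (@le_trans _ _ (\sum_(i < d) (6 * (t - s))%:E)%E).
  by apply: lee_sum => i _; exact: coord_increment_moment_le.
rewrite sumEFin lee_fin sumr_const card_ord -mulr_natr; lra.
Qed.

End wiener_increments.

(** * Dyadic cells and integrals of step functions *)

Section dyadic_grid.
Context (R : realType).
Implicit Types (s : R) (k n : nat).

Definition grid k : R := 1 - 2^-1 ^+ k.

(** Half-open, so that distinct cells are disjoint at every time and a sum over cells can be squared
    term by term. *)
Definition cell k : set R := `[grid k, grid k.+1[.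

Lemma grid0 : grid 0 = 0. Proof. by rewrite /grid expr0 subrr. Qed.

Lemma grid_step k : grid k.+1 - grid k = 2^-1 ^+ k.+1.
Proof. by rewrite /grid exprS; field. Qed.

Lemma half_exp_gt0 k : 0 < 2^-1 ^+ k :> R.
Proof. by rewrite exprn_gt0// invr_gt0. Qed.

Lemma grid_le : {homo grid : k n / (k <= n)%N >-> k <= n}.
Proof.
move=> k n kn; rewrite /grid lerD2l lerN2.
by rewrite ler_wiXn2l// ?invr_ge0// invf_le1// ler1n.
Qed.

Lemma grid_ltS k : grid k < grid k.+1.
Proof. by rewrite -subr_gt0 grid_step half_exp_gt0. Qed.

Lemma grid_ge0 k : 0 <= grid k. Proof. by rewrite -grid0 grid_le. Qed.

Lemma grid_lt1 k : grid k < 1.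
Proof. by rewrite /grid ltrBlDr ltrDl half_exp_gt0. Qed.

Lemma measurable_cell k : measurable (cell k).
Proof. exact: measurable_itv. Qed.

Lemma lebesgue_measure_cell k :
  lebesgue_measure (cell k) = (2^-1 ^+ k.+1)%:E.
Proof.
by rewrite lebesgue_measure_itv/= lte_fin grid_ltS -EFinB grid_step.
Qed.

Lemma cell_indicM k n s :
  \1_(cell k) s * \1_(cell n) s = (k == n)%:R * \1_(cell k) s :> R.
Proof.
have dis i j : (i < j)%N -> \1_(cell i) s * \1_(cell j) s = 0 :> R.
  move=> ij; rewrite !indicE -natrM mulnb; apply/eqP; rewrite pnatr_eq0 eqb0.
  apply/negP => /andP[].
  rewrite !inE /cell /= !in_itv/= => /andP[_ sk] /andP[ns _].
  by have := le_lt_trans ns sk; rewrite ltNge grid_le.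
case: (ltngtP k n) => [kn|nk|->]; rewrite ?mul0r ?mul1r.
- exact: dis.
- by rewrite mulrC dis.
- by rewrite indicE -natrM mulnb andbb.
Qed.

Lemma sqr_cell_sum n (c : nat -> R) s :
  (\sum_(k < n) \1_(cell k) s * c k) ^+ 2
  = \sum_(k < n) \1_(cell k) s * c k ^+ 2.
Proof.
rewrite expr2 big_distrlr/=; apply: eq_bigr => k _.
rewrite (bigD1 k)//= big1 ?addr0 => [|j jk].
  by rewrite mulrACA cell_indicM eqxx mul1r expr2.
by rewrite mulrACA cell_indicM eq_sym (inj_eq val_inj) (negbTE jk) !mul0r.
Qed.

(** The coefficients have no fixed sign, so linearity rests on the integrability of the
    indicators. *)
Lemma integral_cell_sum n (c : nat -> R) :
  (\int[lebesgue_measure]_(s in `[0%R, 1%R])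
     (\sum_(k < n) \1_(cell k) s * c k)%:E
   = (\sum_(k < n) 2^-1 ^+ k.+1 * c k)%:E)%E.
Proof.
under eq_integral do rewrite -sumEFin.
have int_cell k : lebesgue_measure.-integrable `[0%R, 1%R]
    (fun s : R => (\1_(cell k) s)%:E).
  apply: (integrableS measurableT) => //.
  exact: (integrable_indic_itv (grid k) (grid k.+1) true true).
have int_term (k : 'I_n) : lebesgue_measure.-integrable `[0%R, 1%R]
    (fun s : R => (\1_(cell k) s * c k)%:E).
  have : lebesgue_measure.-integrable `[0%R, 1%R]
      (fun s : R => (c k)%:E * (\1_(cell k) s)%:E)%E by exact: integrableZl.
  by apply: eq_integrable => // s _; rewrite -EFinM mulrC.
rewrite integral_sum//.
rewrite -sumEFin; apply: eq_bigr => k _.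
under eq_integral do rewrite EFinM muleC.
rewrite integralZl// integral_indic//; last exact: measurable_cell.
(* Every cell lies inside [0, 1], so it keeps its full length 2^-(k+1). *)
rewrite setIidl.
  have := lebesgue_measure_cell k; rewrite /= => ->.
  by rewrite -EFinM mulrC.
move=> s; rewrite /cell /= !in_itv/= => /andP[ks sk].
rewrite (le_trans (grid_ge0 k) ks)/= ltW//.
exact: lt_trans sk (grid_lt1 _).
Qed.

End dyadic_grid.

(** * The control, its terminal state and its energy *)

Lemma half_expK (R : realType) k : 2^-1 ^+ k * 2 ^+ k = 1 :> R.
Proof. by rewrite -exprMn mulVf// expr1n. Qed.

Section bridge.
Context (R : realType) (d : nat) (Omega : Type)
  (W : R -> Omega -> 'rV[R]_d) (x xi : 'rV[R]_d).

(** For [k] positive this is the increment over the preceding cell, known when cell [k] begins;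
    hence the control can be adapted. *)
Definition jump (k : nat) (w : Omega) : 'rV[R]_d :=
  if k is j.+1 then W (grid R k) w - W (grid R j) w else x - xi.

(** 2^(k+1) is the reciprocal of the length of cell [k], so the integral over that cell is minus the
    jump. *)
Definition bridge (m : nat) (s : R) (w : Omega) : 'rV[R]_d :=
  - \sum_(k < m.+1) (\1_(cell k) s * 2 ^+ k.+1) *: jump k w.

Lemma bridge_coord m s w i :
  bridge m s w 0 i
  = \sum_(k < m.+1) \1_(cell k) s * (- 2 ^+ k.+1 * jump k w 0 i).
Proof.
rewrite /bridge mxE summxE -sumrN; apply: eq_bigr => k _.
by rewrite mxE mulNr mulrN mulrA.
Qed.

Lemma enorm_bridge_sqr m s w :
  enorm (bridge m s w) ^+ 2
  = \sum_(k < m.+1) \1_(cell k) s * ((2 ^+ k.+1) ^+ 2 * enorm (jump k w) ^+ 2).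
Proof.
rewrite enorm_sqr.
under eq_bigr => i _.
  rewrite bridge_coord (sqr_cell_sum _ (fun k => - 2 ^+ k.+1 * jump k w 0 i)).
  over.
rewrite exchange_big/=; apply: eq_bigr => k _.
rewrite enorm_sqr !mulr_sumr; apply: eq_bigr => i _.
by rewrite exprMn sqrrN.
Qed.

Lemma sum_jump m w :
  \sum_(k < m.+1) jump k w = x - xi + (W (grid R m) w - W 0 w).
Proof.
rewrite big_ord_recl/=; congr (_ + _).
by rewrite -(big_mkord xpredT (fun k => W (grid R k.+1) w - W (grid R k) w))
  telescope_sumr// grid0.
Qed.

(** The drift removes all jumps, whose sum telescopes. The [W 0 w] left over cancels the one in
    [state], so the identity is pointwise rather than almost sure. *)
Lemma state_bridge m w :
  state W (bridge m) 0 x 1 w = xi + (W 1 w - W (grid R m) w).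
Proof.
rewrite /state; set I := (\row_i _ : 'rV_d).
have -> : I = - \sum_(k < m.+1) jump k w.
  apply/rowP => i; rewrite !mxE /Rintegral.
  under eq_integral do rewrite bridge_coord.
  rewrite (integral_cell_sum _ (fun k => - 2 ^+ k.+1 * jump k w 0 i))/=.
  rewrite summxE -sumrN; apply: eq_bigr => k _.
  by rewrite mulNr mulrN mulrA half_expK mul1r.
have /= -> := sum_jump m w; apply/rowP => i; rewrite !mxE; ring.
Qed.

(** On cell [k] the squared speed carries 2^(2(k+1)) and the length is 2^-(k+1), which leaves a
    single power. *)
Lemma energy_bridge m w :
  (\int[lebesgue_measure]_(s in `[0%R, 1%R]) (enorm (bridge m s w) ^+ 2)%:E
   = (\sum_(k < m.+1) 2 ^+ k.+1 * enorm (jump k w) ^+ 2)%:E)%E.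
Proof.
under eq_integral do rewrite enorm_bridge_sqr.
rewrite (integral_cell_sum _
  (fun k => (2 ^+ k.+1) ^+ 2 * enorm (jump k w) ^+ 2))/=.
congr (_%:E); apply: eq_bigr => k _.
by rewrite expr2 !mulrA half_expK mul1r.
Qed.

(** Serves to make the moment in [admissible] finite, so it may be crude: with all indicators
    replaced by 1, the speed is at most sqrt S throughout an interval of length 1. *)
Lemma integral_enorm_bridge_sqr_le m w :
  ((\int[lebesgue_measure]_(s in `[0%R, 1%R]) (enorm (bridge m s w))%:E) ^+ 2
   <= (\sum_(k < m.+1) (2 ^+ k.+1) ^+ 2 * enorm (jump k w) ^+ 2)%:E)%E.
Proof.
set S := \sum_(k < m.+1) _.
have S0 : 0 <= S by apply: sumr_ge0 => k _; rewrite mulr_ge0 ?sqr_ge0.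
have intS : (\int[lebesgue_measure]_(s in `[0%R, 1%R])
    (enorm (bridge m s w))%:E <= (Num.sqrt S)%:E)%E.
  apply: (@le_trans _ _ (\int[@lebesgue_measure R]_(s in `[0%R, 1%R])
      (Num.sqrt S)%:E)%E).
    apply: le_integral_unmeasurable => s _; rewrite lee_fin.
    rewrite -(ger0_norm (enorm_ge0 _)) -sqrtr_sqr ler_wsqrtr//.
    rewrite enorm_bridge_sqr; apply: ler_sum => k _.
    apply: ler_piMl; first by rewrite mulr_ge0 ?sqr_ge0.
    by rewrite indicE lern1 leq_b1.
  by rewrite integral_cst//= lebesgue_measure_itv/= lte_fin ltr01 sube0 mule1.
rewrite -[in leRHS](sqr_sqrtr S0) !expe2 EFin_expe expe2.
have int0 : (0 <= \int[lebesgue_measure]_(s in `[0%R, 1%R])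
    (enorm (bridge m s w))%:E)%E.
  by apply: integral_ge0 => s _; rewrite lee_fin enorm_ge0.
exact: lee_pmul.
Qed.

End bridge.

(** * Calculus of bounds on means *)

(** Bundles the bound with what additivity of the integral requires, so that bounds on means combine
    directly. *)
Definition mean_le (R : realType) (disp : measure_display)
    (Omega : measurableType disp) (P : probability Omega R)
    (f : Omega -> R) (b : R) : Prop :=
  [/\ measurable_fun setT f, (forall w, 0 <= f w) &
      (\int[P]_w (f w)%:E <= b%:E)%E].

Section mean_le.
Context (R : realType) (disp : measure_display)
  (Omega : measurableType disp) (P : probability Omega R).
Implicit Types (f g : Omega -> R) (a b c : R).

Lemma mean_le_cst c : 0 <= c -> mean_le P (cst c) c.
Proof.
move=> c0; split=> //.
have -> : (fun w => (cst c w)%:E) = cst c%:E :> (Omega -> \bar R) by [].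
by rewrite integral_cst//= [P _]probability_setT mule1.
Qed.

Lemma mean_leD f g a b :
  mean_le P f a -> mean_le P g b -> mean_le P (fun w => f w + g w) (a + b).
Proof.
move=> [mf f0 fa] [mg g0 gb]; split.
- exact: measurable_funD.
- by move=> w; rewrite addr_ge0.
under eq_integral do rewrite EFinD.
rewrite ge0_integralD//.
- by rewrite EFinD leeD.
- by move=> w _; rewrite lee_fin.
- exact/measurable_EFinP.
- by move=> w _; rewrite lee_fin.
- exact/measurable_EFinP.
Qed.

Lemma mean_leZ c f b :
  0 <= c -> mean_le P f b -> mean_le P (fun w => c * f w) (c * b).
Proof.
move=> c0 [mf f0 fb]; split.
- exact: measurable_funM.
- by move=> w; rewrite mulr_ge0.
under eq_integral do rewrite EFinM.
rewrite ge0_integralZl//.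
- by rewrite EFinM lee_wpmul2l.
- exact/measurable_EFinP.
- by move=> w _; rewrite lee_fin.
Qed.

Lemma mean_le_sum n (f : nat -> Omega -> R) (b : nat -> R) :
  (forall k, mean_le P (f k) (b k)) ->
  mean_le P (fun w => \sum_(k < n) f k w) (\sum_(k < n) b k).
Proof.
move=> fb; elim: n => [|n IHn].
  under eq_fun do rewrite big_ord0; rewrite big_ord0.
  exact: mean_le_cst.
under eq_fun do rewrite big_ord_recr/=; rewrite big_ord_recr/=.
exact: mean_leD.
Qed.

(** [a] will be [G xi] and may be negative. Additivity therefore comes from integrability, which the
    finite bound [b] gives for [f]. *)
Lemma integral_cstD_le a f b : mean_le P f b ->
  (\int[P]_w (a + f w)%:E <= (a + b)%:E)%E.
Proof.
move=> [mf f0 fb].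
have intf : P.-integrable setT (fun w => (f w)%:E).
  apply/integrableP; split; first exact/measurable_EFinP.
  under eq_integral do rewrite gee0_abs ?lee_fin//.
  by apply: le_lt_trans fb _; rewrite ltry.
under eq_integral do rewrite EFinD.
have inta : P.-integrable setT (fun=> a%:E).
  exact: finite_measure_integrable_cst.
rewrite (integralD _ inta intf)//=.
by rewrite integral_cst//= [P _]probability_setT mule1 EFinD leeD2l.
Qed.

End mean_le.

(** * Admissibility of the control *)

Section admissible_bridge.
Context (R : realType) (d : nat) (disp : measure_display)
  (Omega : measurableType disp) (P : probability Omega R)
  (x0 : Omega -> 'rV[R]_d) (W : R -> Omega -> 'rV[R]_d)
  (wienerW : wiener P W).

Lemma measurable_enorm_sqr (X : Omega -> 'rV[R]_d) : random_vector X ->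
  measurable_fun setT (fun w => enorm (X w) ^+ 2).
Proof.
move=> mX; under eq_fun do rewrite enorm_sqr.
by apply: measurable_sum => i; exact: measurable_funX.
Qed.

Lemma mean_le_increment s t : 0 <= s -> s < t ->
  mean_le P (fun w => enorm (W t w - W s w) ^+ 2) (6 * d%:R * (t - s)).
Proof.
move=> s0 st; split; last exact: increment_moment_le.
- apply: measurable_enorm_sqr => i.
  under eq_fun do rewrite !mxE.
  exact: (measurable_increment wienerW).
- by move=> w; exact: sqr_ge0.
Qed.

Lemma mean_le_jump (x xi : 'rV[R]_d) k :
  mean_le P (fun w => enorm (jump W x xi k w) ^+ 2)
    (if k is j.+1 then 6 * d%:R * 2^-1 ^+ k else enorm (x - xi) ^+ 2).
Proof.
case: k => [|k] /=; first exact: mean_le_cst (sqr_ge0 _).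
rewrite -grid_step.
by apply: mean_le_increment; [exact: grid_ge0|exact: grid_ltS].
Qed.

Lemma random_jump (x xi : 'rV[R]_d) k : random_vector (jump W x xi k).
Proof.
case: k => [|k] i; first exact: measurable_cst.
under eq_fun do rewrite !mxE.
by apply: (measurable_increment wienerW); [exact: grid_ge0|exact: grid_ltS].
Qed.

(** The generators of [filtration], named so that [g_sigma_algebraType] makes adaptedness an
    ordinary measurability statement. *)
Let F s := coord_events x0 `|` \bigcup_(r in `[0, s]) coord_events (W r)
  `|` [set N | P.-negligible N].

Lemma filtration_measurable s r (i : 'I_d) : 0 <= r <= s ->
  measurable_fun setT (fun w : g_sigma_algebraType (F s) => W r w 0 i).
Proof.
move=> rs _ B mB; apply: sub_sigma_algebra; left; right.
by exists r; [rewrite /= in_itv|exists i => //; exists B].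
Qed.

(** A cell that starts after [s] contributes 0; a cell that has started involves [W] only at times
    up to its left end, hence up to [s]. *)
Lemma bridge_filtration_measurable (x xi : 'rV[R]_d) m s (i : 'I_d) :
  measurable_fun setT
    (fun w : g_sigma_algebraType (F s) => bridge W x xi m s w 0 i).
Proof.
under eq_fun do rewrite bridge_coord.
apply: measurable_sum => k.
have [ks|sk] := leP (grid R k) s; last first.
  have -> : \1_(cell k) s = 0 :> R.
    by rewrite indicE memNset// /cell /= in_itv/= leNgt sk.
  by under eq_fun do rewrite mul0r; exact: measurable_cst.
apply: measurable_funM => //; apply: measurable_funM => //.
case: (nat_of_ord k) ks => [|j] ks; first exact: measurable_cst.
rewrite /=; under eq_fun do rewrite !mxE.
apply: measurable_funB; apply: filtration_measurable; rewrite grid_ge0//=.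
by apply: le_trans ks; rewrite grid_le.
Qed.

Lemma admissible_bridge (x xi : 'rV[R]_d) m :
  admissible P x0 W (bridge W x xi m).
Proof.
split.
- move=> i.
  (* Each term is a function of time multiplied by a function of the outcome, hence jointly
     measurable. *)
  apply: (eq_measurable_fun (fun z : R * Omega => \sum_(k < m.+1)
      \1_(cell k) z.1 * (- 2 ^+ k.+1 * jump W x xi k z.2 0 i))).
    by move=> z _; rewrite bridge_coord.
  apply: measurable_sum => k; apply: measurable_funM.
    apply: measurable_funTS; apply: measurableT_comp => //.
    by apply: measurable_indic; exact: (measurable_cell k).
  apply: measurable_funM => //; apply: measurable_funTS.
  apply: (measurableT_comp (f := fun w => jump W x xi k w 0 i)) => //.
  exact: random_jump.
- move=> s _ A [i _ [B mB <-]].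
  exact: (bridge_filtration_measurable x xi m i measurableT).
- apply: le_lt_trans (le_integral_unmeasurable P (D := setT)
    (fun w _ => integral_enorm_bridge_sqr_le W x xi m w)) _.
  have mj k := mean_leZ (sqr_ge0 (2 ^+ k.+1)) (mean_le_jump x xi k).
  have [_ _] := mean_le_sum m.+1 mj.
  by move=> /le_lt_trans; apply; exact: ltry.
Qed.

End admissible_bridge.

(** * Elementary inequalities behind the number of cells *)

(** At the scale h = eps^(1/alpha), with z = y / h, the claim is z^alpha <= 1 + z^2: compare with 1
    if z <= 1 and with z^2 otherwise. This reduces the Holder bound to a second moment. *)
Lemma powR_le_sqr (R : realType) (eps alpha y : R) :
  0 < eps -> 0 < alpha -> alpha <= 1 -> 0 <= y ->
  y `^ alpha <= eps * (1 + y ^+ 2 / eps `^ (2 / alpha)).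
Proof.
move=> eps0 alpha0 alpha1 y0.
pose h := eps `^ alpha^-1; have h0 : 0 < h by exact: powR_gt0.
have ha : h `^ alpha = eps by rewrite -powRrM mulVf ?gt_eqF// powRr1// ltW.
have -> : eps `^ (2 / alpha) = h ^+ 2.
  by rewrite -powR_mulrn ?ltW// -powRrM mulrC.
pose z := y / h; have z0 : 0 <= z by rewrite divr_ge0// ltW.
have -> : y = h * z by rewrite mulrC divfK// gt_eqF.
rewrite (powRM _ (ltW h0) z0) ha ler_pM2l// exprMn mulrAC.
rewrite divff ?expf_neq0 ?gt_eqF// mul1r.
have [z1|z1] := leP z 1.
  apply: (@le_trans _ _ 1); last by rewrite lerDl sqr_ge0.
  have := @ge0_ler_powR R alpha (ltW alpha0) z 1.
  by rewrite powR1 !nnegrE; apply.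
rewrite -powR_mulrn//; apply: (@le_trans _ _ (z `^ 2%:R)).
  by rewrite ler_powR ?(ltW z1)//; lra.
by rewrite lerDr.
Qed.

(** Lets terms without a logarithm be absorbed into those with one. *)
Lemma ln_inv_ge1 (R : realType) (eps : R) :
  0 < eps -> eps < expR (- 1) -> 1 <= ln (1 / eps).
Proof.
move=> eps0 eps1; rewrite div1r lnV ?posrE// lerNr -(expRK (-1)).
by rewrite ler_ln ?posrE ?expR_gt0// ltW.
Qed.

(** Since 1/2 <= exp(-1/2), from 1 + x <= exp x, [m] halvings give at most exp(-m/2); hence 4 /
    alpha, twice the exponent 2 / alpha. *)
Lemma half_exp_le_powR (R : realType) (eps alpha : R) (m : nat) :
  0 < eps -> 0 < alpha -> 4 / alpha * ln (1 / eps) <= m%:R ->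
  2^-1 ^+ m <= eps `^ (2 / alpha).
Proof.
move=> eps0 alpha0; rewrite div1r lnV ?posrE// => lem.
have half : 2^-1 <= expR (- 2^-1) :> R.
  by apply: le_trans (expR_ge1Dx _); lra.
apply: (@le_trans _ _ (expR (- 2^-1) ^+ m)).
  by rewrite lerXn2r ?nnegrE ?expR_ge0.
rewrite -expRM_natr /powR gt_eqF// ler_expR.
have -> : 2 / alpha * ln eps = - 2^-1 * (4 / alpha * - ln eps) by field; lra.
rewrite !mulNr lerN2 ler_pM2l//; lra.
Qed.

(** * Bounds on the value at a deterministic starting point *)

Section cost_bounds.
Context (R : realType) (d : nat) (disp : measure_display)
  (Omega : measurableType disp) (P : probability Omega R)
  (x0 : Omega -> 'rV[R]_d) (W : R -> Omega -> 'rV[R]_d)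
  (G : 'rV[R]_d -> R) (L alpha eps : R) (xi : 'rV[R]_d)
  (wienerW : wiener P W) (L0 : 0 < L)
  (alpha0 : 0 < alpha) (alpha1 : alpha <= 1)
  (holderG : forall x y, `|G x - G y| <= L * enorm (x - y) `^ alpha)
  (eps0 : 0 < eps).

(** Holds control by control: the integrand of each cost is at least [G xi] pointwise. *)
Lemma value_ge (x : 'rV[R]_d) :
  argmin G xi -> ((G xi)%:E <= value P x0 W G eps 0 x)%E.
Proof.
move=> Gxi; apply: le_ereal_inf_tmp => _ [theta _ <-].
have -> : (G xi)%:E = (\int[P]_w cst (G xi)%:E w)%E.
  by rewrite integral_cst//= [P _]probability_setT mule1.
apply: le_integral_unmeasurable => w _ /=.
rewrite -[leLHS]adde0 leeD ?lee_fin//.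
rewrite mule_ge0 ?lee_fin ?divr_ge0 ?(ltW eps0)//.
by apply: integral_ge0 => s _; rewrite lee_fin sqr_ge0.
Qed.

Lemma cost_bridge_le (x : 'rV[R]_d) (m : nat) :
  2^-1 ^+ m <= eps `^ (2 / alpha) ->
  (cost P W G eps 0 x (bridge W x xi m)
   <= (G xi + eps * (L * (1 + 6 * d%:R) + 6 * d%:R * m%:R
                     + enorm (x - xi) ^+ 2))%:E)%E.
Proof.
set q := eps `^ _ => qm.
have q0 : 0 < q by exact: powR_gt0.
pose Y w := W 1 w - W (grid R m) w.
(* [f] bounds the excess of the integrand over [G xi]: the Holder condition and [powR_le_sqr] give
   the first two terms, the energy the last. [b] bounds its mean term by term. *)
pose f w := L * eps + L * eps / q * enorm (Y w) ^+ 2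
  + eps / 2 * \sum_(k < m.+1) 2 ^+ k.+1 * enorm (jump W x xi k w) ^+ 2.
pose b := L * eps + L * eps / q * (6 * d%:R * (1 - grid R m))
  + eps / 2 * \sum_(k < m.+1) 2 ^+ k.+1 *
    (if k : nat is j.+1 then 6 * d%:R * 2^-1 ^+ k else enorm (x - xi) ^+ 2).
have Le0 : 0 <= L * eps by rewrite mulr_ge0// ltW.
have mf : mean_le P f b.
  apply: mean_leD; first apply: mean_leD.
  - exact: mean_le_cst.
  - apply: mean_leZ; first by rewrite divr_ge0// ltW.
    by apply: mean_le_increment => //; [exact: grid_ge0|exact: grid_lt1].
  - apply: mean_leZ; first by rewrite divr_ge0// ltW.
    have mj k := mean_leZ (exprn_ge0 k.+1 (ler0n R 2))
      (mean_le_jump wienerW x xi k).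
    exact: mean_le_sum mj.
apply: (@le_trans _ _ (\int[P]_w (G xi + f w)%:E)%E).
  apply: le_integral_unmeasurable => w _.
  have YE : xi + Y w - xi = Y w by rewrite addrC addKr.
  have := holderG (xi + Y w) xi.
  rewrite YE => /(le_trans (ler_norm _)) GY.
  have := powR_le_sqr eps0 alpha0 alpha1 (enorm_ge0 (Y w)).
  rewrite -/q -(ler_pM2l L0) => LY.
  have := le_trans GY LY.
  rewrite [L * (eps * _)](_ : _ =
    L * eps + L * eps / q * enorm (Y w) ^+ 2); last by field; lra.
  move=> GYf; rewrite energy_bridge state_bridge -/(Y w) -EFinM -EFinD lee_fin.
  by rewrite /f [leRHS]addrA lerD2r -lerBlDl.
apply: le_trans (integral_cstD_le (G xi) mf) _.
rewrite lee_fin lerD2l /b big_ord_recl /= expr1.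
(* With cell 0 split off, the index is shifted by one: cell k+1 costs 2^(k+2) times 6 d 2^-(k+1),
   that is 12 d whatever [k]. *)
under eq_bigr => k _.
  rewrite (_ : _ * _ = 12 * d%:R); last first.
    rewrite /bump/= add1n [2 ^+ k.+2]exprS.
    transitivity (12 * d%:R * (2^-1 ^+ k.+1 * 2 ^+ k.+1) : R); first by ring.
    by rewrite half_expK mulr1.
  over.
rewrite sumr_const card_ord -mulr_natr.
have -> : 1 - grid R m = 2^-1 ^+ m by rewrite /grid; ring.
(* Here the choice of [m] enters: the second moment of the final displacement is of order at most
   [q], so the quadratic terminal term is O(eps). *)
have qm1 : 2^-1 ^+ m / q <= 1 by rewrite ler_pdivrMr// mul1r.
have qmd := ler_wpM2l (mulr_ge0 Le0 (mulr_ge0 (ler0n R 6) (ler0n R d))) qm1.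
rewrite [X in _ + X + _](_ : _ = L * eps * (6 * d%:R) * (2^-1 ^+ m / q));
  last by ring.
lra.
Qed.

Lemma value_le (x : 'rV[R]_d) : eps < expR (- 1) ->
  (value P x0 W G eps 0 x
   <= (G xi + eps * (ln (1 / eps) * (L * (1 + 6 * d%:R) + 30 * d%:R / alpha)
                     + enorm (x - xi) ^+ 2))%:E)%E.
Proof.
move=> eps1; set l := ln (1 / eps).
have l1 : 1 <= l by exact: ln_inv_ge1.
have al0 : 0 <= 4 / alpha * l by rewrite mulr_ge0 ?divr_ge0 ?ltW//; lra.
(* Rounding up adds at most 1, itself at most l / alpha since l >= 1 and alpha <= 1. So 4 / alpha
   becomes 5 / alpha, and 6 d m is at most 30 d l / alpha. *)
pose m := (Num.truncn (4 / alpha * l)).+1.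
have [lo hi] : m%:R <= 5 / alpha * l /\ 4 / alpha * l <= m%:R.
  have /andP[lem /ltW ltm] := truncn_itv al0.
  split=> //; rewrite /m -natr1.
  have al1 : 1 <= alpha^-1 * l.
    by rewrite -[leLHS]mulr1; apply: ler_pM => //; rewrite invf_ge1.
  by lra.
have qm := half_exp_le_powR eps0 alpha0 hi.
apply: le_trans (_ : _ <= cost P W G eps 0 x (bridge W x xi m))%E _.
  apply: ereal_inf_lbound; exists (bridge W x xi m) => //.
  exact: admissible_bridge.
apply: le_trans (cost_bridge_le x qm) _.
rewrite lee_fin lerD2l ler_pM2l// lerD2r.
have Ll : 0 <= (l - 1) * (L * (1 + 6 * d%:R)).
  by rewrite mulr_ge0 ?subr_ge0// mulr_ge0 ?(ltW L0)// addr_ge0// mulr_ge0.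
have := ler_wpM2l (mulr_ge0 (ler0n R 6) (ler0n R d)) lo; lra.
Qed.

End cost_bounds.

(** * Averaging over the initial position *)

(** The moment about [xi] is finite by |a - b|^2 <= 2 |a|^2 + 2 |b|^2. Finiteness matters because
    [fine] sends +oo to 0. *)
Lemma mean_le_enormB (R : realType) (d : nat) (disp : measure_display)
    (Omega : measurableType disp) (P : probability Omega R)
    (x0 : Omega -> 'rV[R]_d) (xi : 'rV[R]_d) :
  random_vector x0 -> ('E_P[fun w => (enorm (x0 w) ^+ 2)%R] < +oo)%E ->
  mean_le P (fun w => enorm (x0 w - xi) ^+ 2)
    (fine 'E_P[fun w => (enorm (x0 w - xi) ^+ 2)%R]).
Proof.
rewrite unlock => mx0 x0oo.
have mx : random_vector (fun w => x0 w - xi).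
  move=> i; under eq_fun do rewrite !mxE.
  by apply: measurable_funB => //; exact: mx0.
split; [exact: measurable_enorm_sqr|by move=> w; exact: sqr_ge0|].
rewrite fineK// ge0_fin_numE; last first.
  by apply: integral_ge0 => w _; rewrite lee_fin sqr_ge0.
have [_ _] : mean_le P (fun w => 2 * enorm (x0 w) ^+ 2 + 2 * enorm xi ^+ 2)
    (2 * fine (\int[P]_w (enorm (x0 w) ^+ 2)%:E) + 2 * enorm xi ^+ 2).
  apply: mean_leD; last by apply: mean_le_cst; rewrite mulr_ge0 ?sqr_ge0.
  apply: mean_leZ => //; split; first exact: measurable_enorm_sqr.
    by move=> w; exact: sqr_ge0.
  rewrite fineK// ge0_fin_numE//.
  by apply: integral_ge0 => w _; rewrite lee_fin sqr_ge0.
move=> /le_lt_trans -/(_ +oo%E (ltry _)); apply: le_lt_trans.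
apply: le_integral_unmeasurable => w _; rewrite lee_fin !enorm_sqr.
rewrite !mulr_sumr -big_split/=; apply: ler_sum => i _; rewrite !mxE.
rewrite -subr_ge0 (_ : _ - _ = (x0 w 0 i + xi 0 i) ^+ 2) ?sqr_ge0//; ring.
Qed.

Theorem theorem1p1 (R : realType) :
  exists C : nat -> R -> R -> R -> R,
  forall (d : nat) (disp : measure_display) (Omega : measurableType disp)
    (P : probability Omega R) (x0 : Omega -> 'rV[R]_d)
    (W : R -> Omega -> 'rV[R]_d) (G : 'rV[R]_d -> R) (L M alpha : R),
  measure_is_complete P ->
  random_vector x0 ->
  wiener P W ->
  indep P (sigma_vector x0) (sigma_process `[0, +oo[ W) ->
  0 < L -> 0 < M -> 0 < alpha -> alpha <= 1 ->
  (forall x, `|G x| <= M) ->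
  (forall x y, `|G x - G y| <= L * enorm (x - y) `^ alpha) ->
  ('E_P[fun w => (enorm (x0 w) ^+ 2)%R] < +oo)%E ->
  forall xi : 'rV[R]_d, argmin G xi ->
  forall eps : R, 0 < eps -> eps < expR (- 1) ->
  (0 <= \int[P]_w value P x0 W G eps 0 (x0 w) - (G xi)%:E
     <= (C d L alpha (fine 'E_P[fun w => (enorm (x0 w - xi) ^+ 2)%R])
         * eps * ln (1 / eps))%:E)%E.
Proof.
(* The three terms come from the terminal cost, the energy of the cells after the first, and the
   energy of the first cell. *)
exists (fun d L alpha v => L * (1 + 6 * d%:R) + 30 * d%:R / alpha + v).
move=> d disp Omega P x0 W G L M alpha _ mx0 wW _ L0 _ alpha0 alpha1 _ holderG.
move=> x0oo xi Gxi eps eps0 eps1; set v := fine _.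
have [mv v_ge0 intv] := mean_le_enormB xi mx0 x0oo.
have v0 : 0 <= v.
  rewrite -lee_fin; apply: le_trans intv.
  by apply: integral_ge0 => w _; rewrite lee_fin.
have l1 := ln_inv_ge1 eps0 eps1.
set K := L * (1 + 6 * d%:R) + 30 * d%:R / alpha.
have K0 : 0 <= K.
  apply: addr_ge0; last by rewrite divr_ge0 ?(ltW alpha0)// mulr_ge0.
  by rewrite mulr_ge0 ?(ltW L0)// addr_ge0// mulr_ge0.
apply/andP; split.
  rewrite sube_ge0//.
  have -> : (G xi)%:E = (\int[P]_w cst (G xi)%:E w)%E.
    by rewrite integral_cst//= [P _]probability_setT mule1.
  by apply: le_integral_unmeasurable => w _; exact: value_ge.
rewrite leeBlDr// -EFinD.
have mf : mean_le P (fun w => eps * (ln (1 / eps) * K + enorm (x0 w - xi) ^+ 2))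
    (eps * (ln (1 / eps) * K + v)).
  apply: mean_leZ; first exact: ltW.
  apply: mean_leD => //; apply: mean_le_cst.
  by rewrite mulr_ge0//; lra.
(* For each outcome the starting point is a fixed vector, with its own control. The resulting bound
   is affine in |x - xi|^2, so it can be averaged. *)
have vle w := value_le x0 xi wW L0 alpha0 alpha1 holderG eps0 (x0 w) eps1.
apply: le_trans (le_integral_unmeasurable P (D := setT) (fun w _ => vle w)) _.
apply: le_trans (integral_cstD_le (G xi) mf) _.
(* Only [v] still lacks the factor ln (1 / eps), which is at least 1. *)
rewrite lee_fin [leRHS]addrC lerD2l [leRHS]mulrAC [leRHS]mulrC ler_pM2l//.
by rewrite mulrDl [K * _]mulrC lerD2l ler_peMr.
Qed.
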